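(* Let $\mathcal P\subset\mathbb R^{a-1}$ (with $a-1\ge1$) be compact with non-empty interior, let $T>0$, and for each $\mu\in\mathcal P$ consider the ODE $\dot u_N=F_N(u_N;\mu)$ on $(0,T]$, $u_N(0)=u_{N0}(\mu)$, with values in $\mathbb R^N$. Assume that $F_N$ and $u_{N0}$ depend continuously on $\mu$, that the ODE is well-posed for each $\mu\in\mathcal P$, and that for every $(t^*,\mu^* )\in[0,T]\times\mathcal P$ the map $B_r((t^*,\mu^* ))\ni(t,\mu)\mapsto u_N(t;\mu)$ is injective for $r>0$ small enough. Then the minimum latent dimension $n$ of $\mathcal M=\{u_N(t;\mu)\}_{t\in[0,T],\,\mu\in\mathcal P}$ satisfies $n\le 2a+1$.
   Context: $u_N(t;\mu)$ denotes the solution at time $t$ for parameter $\mu$. $B_r((t^*,\mu^* ))$ is the closed ball of radius $r$ centred at $(t^*,\mu^* )$, understood within $[0,T]\times\mathcal P$. Well-posed means that the solution exists on $[0,T]$, is unique, and depends continuously on the data. The minimum latent dimension of $\mathcal M\subset\mathbb R^N$ is the smallest $n$ for which there is a continuous injective map (encoder) $\Psi':\mathcal M\to\mathbb R^n$, so that $\mathcal M$ can be encoded without loss of information, i.e. there is a decoder $\Psi$ with $\Psi\circ\Psi'=\mathrm{Id}_{\mathcal M}$. *)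

(* Defs.v *)
From mathcomp Require Import all_boot all_order all_algebra.
From mathcomp Require Import all_classical all_reals all_analysis.
Export numFieldNormedType.Exports.

Set Implicit Arguments.
Unset Strict Implicit.
Unset Printing Implicit Defensive.

Import Order.TTheory GRing.Theory Num.Theory.

Local Open Scope classical_set_scope.
Local Open Scope ring_scope.

(* The derivative is taken within [0, T], so it is two-sided on ]0, T[ and
   one-sided at T. Only the values of u on [0, T] matter. *)
Definition is_solution (R : realType) (N : nat) (T : R)
    (F : 'rV[R]_N -> 'rV[R]_N) (u0 : 'rV[R]_N) (u : R -> 'rV[R]_N) : Prop :=
  [/\ {within `[0, T], continuous u},
      u 0 = u0 &
      forall t, t \in `]0, T] ->
        (s - t)^-1 *: (u s - u t) @[s --> within `[0, T] t^'] --> F (u t)].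

(* The data are the vector field and the initial value. Vector fields carry
   the topology of uniform convergence on compact sets, and trajectories that
   of uniform convergence on [0, T]. *)
Definition depends_continuously (R : realType) (N : nat) (T : R)
    (F : 'rV[R]_N -> 'rV[R]_N) (u0 : 'rV[R]_N) (u : R -> 'rV[R]_N) : Prop :=
  forall e : R, 0 < e ->
    \forall G \near (F : {family compact, 'rV[R]_N -> 'rV[R]_N}) &
            v0 \near u0,
      forall v, is_solution T G v0 v ->
        forall t, t \in `[0, T] -> `|v t - u t| < e.

Definition well_posed (R : realType) (N : nat) (T : R)
    (F : 'rV[R]_N -> 'rV[R]_N) (u0 : 'rV[R]_N) : Prop :=
  exists u, [/\ is_solution T F u0 u,
    forall v, is_solution T F u0 v -> {in `[0, T], v =1 u} &
    depends_continuously T F u0 u].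

Definition solution_manifold (R : realType) (N p : nat) (T : R)
    (P : set 'rV[R]_p) (u : R -> 'rV[R]_p -> 'rV[R]_N) : set 'rV[R]_N :=
  [set u t mu | t in `[0, T] & mu in P].

Definition continuous_encoder (R : realType) (N n : nat) (M : set 'rV[R]_N)
    (enc : 'rV[R]_N -> 'rV[R]_n) : Prop :=
  {within M, continuous enc} /\ set_inj M enc.

Definition encodable (R : realType) (N : nat) (M : set 'rV[R]_N) (n : nat)
    : Prop :=
  exists enc : 'rV[R]_N -> 'rV[R]_n, continuous_encoder M enc.

(* Injectivity of the encoder on M is what makes the encoding lossless. *)
Lemma continuous_encoder_decoder (R : realType) (N n : nat)
    (M : set 'rV[R]_N) (enc : 'rV[R]_N -> 'rV[R]_n) :
  continuous_encoder M enc ->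
  exists dec : 'rV[R]_n -> 'rV[R]_N, {in M, cancel enc dec}.
Proof.
move=> [_ enc_inj]; exists (pinv_ (fun=> 0) M enc) => x xM.
exact: pinvKV.
Qed.

Lemma encodable_ex (R : realType) (N : nat) (M : set 'rV[R]_N) :
  exists n, `[< encodable M n >].
Proof.
exists N; apply/asboolP; exists id; split; last by move=> x y.
by apply: continuous_subspaceT => x; exact: cvg_id.
Qed.

Definition min_latent_dim (R : realType) (N : nat) (M : set 'rV[R]_N) : nat :=
  ex_minn (encodable_ex M).

(* Main.v *)
Require Import Defs.
From mathcomp Require Import all_boot all_order all_algebra.
From mathcomp Require Import all_classical all_reals all_analysis.
From mathcomp Require Import ring lra.

Set Implicit Arguments.
Unset Strict Implicit.
Unset Printing Implicit Defensive.

Import Order.TTheory GRing.Theory Num.Theory.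
Import numFieldNormedType.Exports.

Local Open Scope classical_set_scope.
Local Open Scope ring_scope.

(** The solution manifold [M] is the image of the compact set
    [K = [0, T] x P], a subset of [R^a], by the map [phi : (t, mu) |-> u t mu].
    This map is continuous, because trajectories are continuous and depend on
    the data uniformly in time ([solution_map_continuous]), and it is injective
    near each point of [K]. Hence [M] is a finite union of homeomorphic copies
    of compact subsets of [R^a], so its topological dimension is at most [a],
    and the Menger-Noebeling theorem embeds it in [R^(2 a + 1)].

    The proof below obtains such an embedding without dimension theory. It
    constructs a continuous function on the ambient space [R^N] with values in
    [R^n], [n = 2 a + 1], that is injective on [M]. Two distinct points of [M]
    are the images of points of two small compact pieces [A] and [B] of [K] such
    that [phi] is injective on [A `|` B]. Given a continuous [f], an arbitrarily
    small perturbation of [f] takes disjoint values on [phi @` A] and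
    [phi @` B] ([separating_perturbation]): after a Lipschitz approximation of
    [f \o phi] ([lipschitz_approximation]), the differences of values on [A] and
    on [B] form a Lipschitz image of a bounded subset of [R^(2 a)], and such an
    image has empty interior in [R^(2 a + 1)] ([lipschitz_image_gap]); a small
    translation on [A] therefore separates the two images, and Tietze's theorem
    extends the perturbation to [R^N] ([extension_from_image]).

    Countably many pairs of pieces suffice. A sequence of perturbations with
    rapidly decreasing tolerances treats all of them, and its uniform limit is
    the encoder ([iterated_separation]). *)

(** * Sup norm, uniform continuity, Lipschitz images *)

Lemma row_norm_leP (R : realType) n (x : 'rV[R]_n) (r : R) : 0 <= r ->
  `|x| <= r <-> forall i, `|x ord0 i| <= r.
Proof.
move=> r0; rewrite [`|x|]/Num.norm/= mx_normrE; split.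
  by move=> /bigmax_leP[_ xr] i; exact: (xr (ord0, i)).
by move=> xr; apply/bigmax_leP; split => // -[i j] _ /=; rewrite ord1.
Qed.

Lemma row_norm_ge (R : realType) n (x : 'rV[R]_n) i : `|x ord0 i| <= `|x|.
Proof. by move: i; apply/row_norm_leP. Qed.

Lemma compact_unif_continuous (R : realType) (U V : normedModType R) (C : set U)
    (f : U -> V) :
  compact C -> {within C, continuous f} ->
  forall e, 0 < e -> exists2 d, 0 < d &
    forall x y, C x -> C y -> `|x - y| < d -> `|f x - f y| < e.
Proof.
move=> /compact_near_coveringP/near_covering_withinP cC.
move=> /subspace_continuousP fC e e0.
have : \forall d \near 0^'+, C `<=` [set x | forall y, C y ->
    `|x - y| < d -> `|f x - f y| < e].
  apply: cC => x Cx.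
  have /cvgrPdist_lt/(_ (e / 2)) := fC x Cx.
  rewrite divr_gt0// => /(_ isT); rewrite near_withinE.
  move=> /nbhs_ballP[r/= r0 xr].
  have r2 : 0 < r / 2 by rewrite divr_gt0.
  exists (ball x (r / 2), [set d | d < r / 2]) => /=.
    by split; [exact: nbhsx_ballx | exact: nbhs_right_lt].
  move=> [x' d]/= [xx' dr] Cx' y Cy x'y.
  have fx' : `|f x - f x'| < e / 2.
    apply: xr => //; apply: le_ball xx'.
    by rewrite ler_pdivrMr// ler_peMr ?ltW// ltr1n.
  have fy : `|f x - f y| < e / 2.
    apply: xr => //; rewrite -ball_normE/= -(subrKA x').
    rewrite (le_lt_trans (ler_normD _ _))// [ltRHS]splitr ltrD//.
      by move: xx'; rewrite -ball_normE.
    exact: lt_trans dr.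
  rewrite -(subrKA (f x)) (le_lt_trans (ler_normD _ _))// [ltRHS]splitr ltrD//.
  by rewrite distrC.
move=> /(filterI (nbhs_right_gt 0))/filter_ex[d [d0 dC]].
by exists d => // x y Cx Cy; exact: dC.
Qed.

(** Pigeonhole. With [m] values per coordinate a grid of mesh [e / m] near the
    origin of [R^n] has [m ^ n] points, whereas the cells of side proportional
    to [1 / m] covering [X] number only [O(m ^ d)]. If every grid point were
    close to some [h z], two of them would thus come from points of one cell,
    and the Lipschitz bound would bring them closer than [e / m]. The positive
    gap makes the avoidance stable under later small perturbations. *)
Lemma lipschitz_image_gap (R : realType) (d n : nat) (X : set 'rV[R]_d)
    (h : 'rV[R]_d -> 'rV[R]_n) (S L e : R) :
  (d < n)%N -> 0 < e -> (forall z, X z -> `|z| <= S) ->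
  (forall z w, X z -> X w -> `|h z - h w| <= L * `|z - w|) ->
  exists2 v, `|v| <= e &
    exists2 g, 0 < g & forall z, X z -> g < `|v - h z|.
Proof.
move=> dn e0 XS hL.
(* [L] and [S] are arbitrary; positive bounds are needed to divide by. *)
pose L' := `|L| + 1; pose S' := `|S| + 1.
have L'0 : 0 < L' by rewrite ltr_pwDr.
have S'0 : 0 < S' by rewrite ltr_pwDr.
pose D := (Num.truncn (8 * S' * L' / e)).+1.
have eD : 8 * S' * L' / e < D%:R.
  have /truncn_itv/andP[] // : 0 <= 8 * S' * L' / e.
  by rewrite divr_ge0 ?mulr_ge0 ?ltW.
(* There are [(D * m) ^ d] cells, and [D ^ d < m] makes this less than
   [m ^ d.+1]. *)
pose m := (D ^ d).+1; pose M := (D * m).-1.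
have DmM : M.+1 = (D * m)%N by rewrite prednK// muln_gt0.
have m0 : 0 < m%:R :> R by rewrite ltr0n.
(* Two points of a cell have images at distance at most [e / (4 * m)]; the two
   errors [g] bring the total to half of the mesh [e / m]. *)
pose s := e / (4 * L' * m%:R).
have s0 : 0 < s by rewrite divr_gt0// !mulr_gt0.
pose g := e / (8 * m%:R).
have g0 : 0 < g by rewrite divr_gt0// !mulr_gt0.
pose v (k : {ffun 'I_n -> 'I_m}) : 'rV[R]_n := \row_i (e / m%:R * (k i)%:R).
have ve k : `|v k| <= e.
  apply/row_norm_leP => [|i]; first exact: ltW.
  rewrite mxE ger0_norm; last first.
    by rewrite mulr_ge0// divr_ge0// ltW.
  rewrite -mulrA ler_piMr ?(ltW e0)// mulrC ler_pdivrMr// mul1r ler_nat.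
  exact: ltnW.
apply: contrapT => noV.
have /choice[Z ZP] : forall k, exists z, X z /\ `|v k - h z| <= g.
  move=> k; apply: contrapT => kz; apply: noV; exists (v k) => //.
  exists g => // z Xz; rewrite ltNge; apply/negP => kg.
  by apply: kz; exists z.
pose y k i := (Z k ord0 i + S') / s.
have ZS k i : `|Z k ord0 i| <= S'.
  rewrite (le_trans (row_norm_ge _ _))//.
  rewrite (le_trans (XS _ (ZP k).1))// (le_trans (ler_norm _))//.
  by rewrite lerDl.
have y0 k i : 0 <= y k i.
  apply: divr_ge0; last exact: ltW.
  have := ZS k i; rewrite ler_norml; lra.
have yM k i : (Num.truncn (y k i) < M.+1)%N.
  rewrite -(ltr_nat R); have /truncn_itv/andP[yi _] := y0 k i.
  apply: (le_lt_trans yi); rewrite DmM natrM.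
  apply: (@le_lt_trans _ _ (8 * S' * L' / e * m%:R)); last by rewrite ltr_pM2r.
  rewrite /y ler_pdivrMr//.
  have -> : 8 * S' * L' / e * m%:R * s = 2 * S'.
    rewrite /s; field; rewrite !gt_eqF//.
  have := ZS k i; rewrite ler_norml; lra.
pose idx k : {ffun 'I_d -> 'I_M.+1} := [ffun i => inord (Num.truncn (y k i))].
have idx_inj : injective idx.
  move=> k l kl.
  have Zkl : `|Z k - Z l| <= s.
    apply/row_norm_leP => [|i]; first exact: ltW.
    have tkl : Num.truncn (y k i) = Num.truncn (y l i).
      have := congr1 (fun f : {ffun _ -> _} => val (f i)) kl.
      by rewrite !ffunE /= !inordK.
    have : `|y k i - y l i| <= 1.
      have /truncn_itv := y0 k i; have /truncn_itv := y0 l i.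
      rewrite tkl -addn1 natrD => /andP[? ?] /andP[? ?].
      by rewrite ler_norml; lra.
    rewrite !mxE /y -mulrBl normrM normfV (gtr0_norm s0) ler_pdivrMr// mul1r.
    by rewrite opprD addrACA subrr addr0.
  have hkl : `|h (Z k) - h (Z l)| <= e / (4 * m%:R).
    rewrite (le_trans (hL _ _ (ZP k).1 (ZP l).1))//.
    apply: (@le_trans _ _ (L' * s)).
      rewrite (@le_trans _ _ (L' * `|Z k - Z l|)) ?ler_pM2l// ler_wpM2r//.
      by rewrite (le_trans (ler_norm _))// lerDl.
    rewrite /s le_eqVlt; apply/orP; left; apply/eqP; field.
    by rewrite !gt_eqF.
  have vkl : `|v k - v l| < e / m%:R.
    have -> : v k - v l =
        (v k - h (Z k)) + (h (Z k) - h (Z l)) - (v l - h (Z l)).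
      by rewrite subrKA opprB subrKA.
    apply: (@le_lt_trans _ _ (g + e / (4 * m%:R) + g)).
      rewrite (le_trans (ler_normB _ _))// lerD ?(ZP l).2//.
      by rewrite (le_trans (ler_normD _ _))// lerD ?(ZP k).2.
    have -> : g + e / (4 * m%:R) + g = e / m%:R / 2.
      by rewrite /g; field; rewrite !gt_eqF.
    by rewrite ltr_pdivrMr// ltr_pMr ?divr_gt0// ltr1n.
  apply/ffunP => i; apply/val_inj/eqP; apply/negPn/negP => kli.
  suff : e / m%:R <= `|v k - v l| by rewrite leNgt vkl.
  apply: le_trans (row_norm_ge _ i).
  rewrite !mxE -mulrBr normrM gtr0_norm ?divr_gt0//.
  rewrite ler_peMr ?(divr_ge0 (ltW e0) (ltW m0))//.
  move: kli; rewrite /= neq_ltn => /orP[] kli.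
    rewrite distrC -natrB ?(ltnW kli)// normr_nat ler1n subn_gt0//.
  by rewrite -natrB ?(ltnW kli)// normr_nat ler1n subn_gt0.
have := leq_card _ idx_inj.
rewrite !card_ffun !card_ord DmM leqNgt => /negP; apply.
apply: (@leq_trans (m ^ d.+1)); last by rewrite leq_pexp2l.
by rewrite expnMn expnS ltn_mul2r expn_gt0 /= ltnSn.
Qed.

(** * Lipschitz approximation and extension *)

Lemma lipschitz_bound_continuous (R : realType) (U V : normedModType R)
    (g : U -> V) (L : R) :
  (forall x y, `|g x - g y| <= L * `|x - y|) -> continuous g.
Proof.
move=> gL x; apply/cvgrPdist_lt => e e0.
pose L' := `|L| + 1.
have L'0 : 0 < L' by rewrite ltr_pwDr.
apply/nbhs_ballP; exists (e / L'); first by rewrite /= divr_gt0.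
move=> y; rewrite -ball_normE/= ltr_pdivlMr// mulrC => xy.
apply: le_lt_trans xy; apply: le_trans (gL _ _) _.
by rewrite ler_wpM2r// (le_trans (ler_norm _))// lerDl.
Qed.

(** The approximation is the infimal convolution
    [inf_w (f w + L * `|x - w|)] of each coordinate: an infimum of [L]-Lipschitz
    functions is [L]-Lipschitz. Points [w] near [x] contribute at least
    [f x - e] by uniform continuity, and for [w] farther than [dl] the penalty
    [L * dl = 2 * B] outweighs the oscillation of [f]. *)
Lemma lipschitz_approximation (R : realType) (U : normedModType R) n
    (C : set U) (f : U -> 'rV[R]_n) (e : R) :
  compact C -> {within C, continuous f} -> 0 < e ->
  exists (g : U -> 'rV[R]_n) (L : R),
    (forall x y, `|g x - g y| <= L * `|x - y|) /\
    (forall x, C x -> `|g x - f x| <= e).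
Proof.
move=> cC fC e0; have [->|/set0P[c Cc]] := eqVneq C set0.
  exists (fun=> 0), 0; split => // x y; by rewrite subrr normr0 mul0r.
have [dl dl0 fdl] := compact_unif_continuous cC fC e0.
have [B0 [_ /(_ (`|B0| + 1))]] := compact_bounded (continuous_compact fC cC).
set B := `|B0| + 1 => /(_ _)/wrap[].
  by rewrite /B (le_lt_trans (ler_norm _))// ltrDl.
move=> fB; have {}fB x i : C x -> `|f x ord0 i| <= B.
  by move=> Cx; rewrite (le_trans (row_norm_ge _ _))//; apply: fB; exists x.
have B0' : 0 < B by rewrite ltr_pwDr.
pose L := 2 * B / dl; have L0 : 0 < L by rewrite divr_gt0// mulr_gt0.
pose E i x := [set f w ord0 i + L * `|x - w| | w in C].
have E0 i x : E i x !=set0 by exists (f c ord0 i + L * `|x - c|), c.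
have Elb i x : has_lbound (E i x).
  exists (- B) => _ [w Cw <-]; have := fB w i Cw.
  rewrite ler_norml => /andP[+ _].
  by move=> /le_trans; apply; rewrite lerDl mulr_ge0// ltW.
have ELip i x y : inf (E i x) <= inf (E i y) + L * `|x - y|.
  rewrite -lerBlDr; apply: lb_le_inf => // _ [w Cw <-].
  rewrite lerBlDr; apply: (@le_trans _ _ (f w ord0 i + L * `|x - w|)).
    by apply: ge_inf => //; exists w.
  rewrite -addrA lerD2l -mulrDr ler_pM2l// -(subrKA y x) [leRHS]addrC.
  exact: ler_normD.
exists (fun x => \row_i inf (E i x)), L; split => [x y|x Cx].
  apply/row_norm_leP => [|i]; first by rewrite mulr_ge0// ltW.
  rewrite !mxE ler_norml; have := ELip i x y; have := ELip i y x.
  by rewrite (distrC y x); lra.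
apply/row_norm_leP => [|i]; first exact: ltW.
rewrite !mxE ler_norml; apply/andP; split.
  rewrite lerBrDr; apply: lb_le_inf => // _ [w Cw <-].
  have [xw|xw] := ltP `|x - w| dl.
    have := le_trans (row_norm_ge (f x - f w) i) (ltW (fdl x w Cx Cw xw)).
    rewrite !mxE ler_norml => /andP[_ +].
    have : 0 <= L * `|x - w| by rewrite mulr_ge0// ltW.
    lra.
  have : 2 * B <= L * `|x - w|.
    by rewrite /L mulrAC ler_pdivlMr// ler_pM2l ?mulr_gt0.
  have := fB x i Cx; have := fB w i Cw; rewrite !ler_norml; lra.
rewrite lerBlDr; apply: (@le_trans _ _ (f x ord0 i + L * `|x - x|)).
  by apply: ge_inf => //; exists x.
by rewrite subrr normr0 mulr0 addr0 lerDr ltW.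
Qed.

Lemma row_continuous (R : realType) (X : topologicalType) n
    (G : 'I_n -> X -> R^o) :
  (forall i, continuous (G i)) -> continuous (fun x => \row_i G i x : 'rV[R]_n).
Proof.
move=> Gc x; apply/cvgrPdist_le => e e0.
have : \forall y \near x, forall i, `|G i x - G i y| <= e.
  by apply: filter_forall => i; move/cvgrPdist_le : (Gc i x); exact.
apply: filterS => y xy; apply/row_norm_leP; first exact: ltW.
by move=> i; rewrite !mxE.
Qed.

(** A continuous injection of a compact set is a homeomorphism onto its closed
    image, so [q] transported by [phi^-1] is continuous there and Tietze's
    theorem applies to each coordinate. *)
Lemma extension_from_image (R : realType) (U : normedModType R) (N n : nat)
    (C : set U)
    (phi : U -> 'rV[R]_N) (q : U -> 'rV[R]_n) (M : R) :
  compact C -> {within C, continuous phi} -> set_inj C phi ->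
  {within C, continuous q} -> 0 < M -> (forall z, C z -> `|q z| <= M) ->
  exists p : 'rV[R]_N -> 'rV[R]_n, [/\ continuous p,
    forall x, `|p x| <= M & forall z, C z -> p (phi z) = q z].
Proof.
move=> cC phiC phi_inj qC M0 qM.
have : forall x, exists z, (phi @` C) x -> C z /\ phi z = x.
  move=> x; have [[z Cz zx]|nx] := pselect ((phi @` C) x).
    by exists z.
  by exists 0.
move=> /choice[psi psiP].
have psiK z : C z -> psi (phi z) = z.
  move=> Cz; have [] := psiP (phi z); first by exists z.
  by move=> ? ?; apply: phi_inj => //; rewrite inE.
have closed_img A : compact A -> closed (A : set 'rV[R]_N).
  by move=> cA; apply: compact_closed cA; exact: norm_hausdorff.
have cphiC : closed (phi @` C).
  by apply: closed_img; exact: continuous_compact.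
pose Q i x : R^o := q (psi x) ord0 i.
have Qc i : {within phi @` C, continuous (Q i)}.
  apply/continuous_closedP => E cE; apply/closed_subspaceP.
  pose D := C `&` [set z | E (q z ord0 i)].
  have cD : compact D.
    have : closed ((fun z => q z ord0 i : R^o) @^-1` E : set (subspace C)).
      apply: closed_comp cE => z _.
      exact: (continuous_comp (qC z) (@coord_continuous _ _ _ _ _ _)).
    move=> /closed_subspaceP[W cW WE].
    have -> : D = C `&` W by rewrite setIC /D setIC -WE.
    exact: compact_closedI.
  exists (phi @` D).
    apply: closed_img; apply: continuous_compact => //.
    by apply: continuous_subspaceW phiC => z [].
  apply/seteqP; split => x /=.
    move=> [[z [Cz Ez] <-] _]; split; last by exists z.
    by rewrite /Q/from_subspace psiK.
  move=> [Ex [z Cz zx]]; split; last by exists z.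
  exists z => //; split => //; move: Ex; rewrite /Q/from_subspace -zx psiK//.
have : forall i, exists G : 'rV[R]_N -> R^o, [/\ {in phi @` C, Q i =1 G},
    continuous G & forall x, `|G x| <= M].
  move=> i; apply: continuous_bounded_extension => //.
    exact: pseudometric_normal.
  move=> _ [z Cz <-]; rewrite /Q psiK//.
  by rewrite (le_trans (row_norm_ge _ _))// qM.
move=> /choice[G GP].
exists (fun x => \row_i G i x); split.
- by apply: row_continuous => i; have [] := GP i.
- move=> x; apply/row_norm_leP; first exact: ltW.
  by move=> i; rewrite mxE; have [_ _] := GP i; exact.
- move=> z Cz; apply/rowP => i; rewrite mxE; have [QG _ _] := GP i.
  by rewrite -QG ?inE; [rewrite /Q psiK | exists z].
Qed.

(** * Perturbations separating two compact pieces *)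

(** The function [f \o phi] is first replaced on [A `|` B] by a nearby
    Lipschitz [g]. Then [(a, b) |-> g b - g a] is a Lipschitz map defined on a
    bounded part of [R^(d + d)], hence misses some small [v] because
    [d + d < n]; adding [v] to [g] on [A] separates the two images. The
    resulting change of [f \o phi], of size at most [e], is the restriction of
    a function of the same size on [R^N]. *)
Lemma separating_perturbation (R : realType) (d N n : nat)
    (A B : set 'rV[R]_d) (phi : 'rV[R]_d -> 'rV[R]_N)
    (f : 'rV[R]_N -> 'rV[R]_n) (e : R) :
  (d + d < n)%N -> compact A -> compact B -> A `&` B = set0 ->
  {within A `|` B, continuous phi} -> set_inj (A `|` B) phi ->
  continuous f -> 0 < e ->
  exists2 f' : 'rV[R]_N -> 'rV[R]_n,
    continuous f' /\ (forall x, `|f' x - f x| <= e) &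
    exists2 g, 0 < g & forall a b, A a -> B b ->
      g < `|f' (phi a) - f' (phi b)|.
Proof.
move=> dn cA cB AB0 phic phi_inj fc e0.
have e2 : 0 < e / 2 by rewrite divr_gt0.
have cC : compact (A `|` B) by exact: compactU.
have fphic : {within A `|` B, continuous (f \o phi)}.
  by apply: within_continuous_comp => // y _; exact: fc.
have [g [L [gL gf]]] := lipschitz_approximation cC fphic e2.
have lsub (w : 'rV[R]_(d + d)) : `|lsubmx w| <= `|w|.
  by apply/row_norm_leP => // i; rewrite mxE row_norm_ge.
have rsub (w : 'rV[R]_(d + d)) : `|rsubmx w| <= `|w|.
  by apply/row_norm_leP => // i; rewrite mxE row_norm_ge.
pose X := [set w : 'rV[R]_(d + d) | A (lsubmx w) /\ B (rsubmx w)].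
pose h (w : 'rV[R]_(d + d)) := g (rsubmx w) - g (lsubmx w).
have [S [_ /(_ (`|S| + 1))SX]] := compact_bounded cC.
have XS w : X w -> `|w| <= `|S| + 1.
  move=> [Aw Bw]; have {}SX z : (A `|` B) z -> `|z| <= `|S| + 1.
    by apply: SX; rewrite (le_lt_trans (ler_norm _))// ltrDl.
  rewrite -(hsubmxK w); apply/row_norm_leP; first by rewrite addr_ge0.
  move=> i; rewrite mxE; case: splitP => j _.
    by rewrite (le_trans (row_norm_ge _ _))//; apply: SX; left.
  by rewrite (le_trans (row_norm_ge _ _))//; apply: SX; right.
have hL w w' : X w -> X w' -> `|h w - h w'| <= (`|L| + `|L|) * `|w - w'|.
  have gL' x y : `|g x - g y| <= `|L| * `|x - y|.
    by rewrite (le_trans (gL _ _))// ler_wpM2r// ler_norm.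
  move=> _ _; rewrite /h opprD addrACA -opprD.
  rewrite (le_trans (ler_normB _ _))// mulrDl lerD//.
    by rewrite (le_trans (gL' _ _))// ler_wpM2l// -[_ - _]raddfB rsub.
  by rewrite (le_trans (gL' _ _))// ler_wpM2l// -[_ - _]raddfB lsub.
have [v ve [eta eta0 gap]] := lipschitz_image_gap dn e2 XS hL.
have clA : closed A by apply: compact_closed cA; exact: norm_hausdorff.
have clB : closed B by apply: compact_closed cB; exact: norm_hausdorff.
have AnB z : B z -> z \in A = false.
  move=> Bz; apply/negbTE/negP; rewrite inE => Az.
  by have : (A `&` B) z by []; rewrite AB0.
have gc : continuous g := lipschitz_bound_continuous gL.
pose q z := g z + (if z \in A then v else 0) - f (phi z).
have qc : {within A `|` B, continuous q}.
  have : {within A `|` B, continuous (fun z => g z + if z \in A then v else 0)}.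
    apply: withinU_continuous => //.
      apply: (@subspace_eq_continuous _ _ _ (fun z => g z + v)) => [z zA|].
        by rewrite /from_subspace zA.
      apply: continuous_subspaceT => z; apply: continuousD; first exact: gc.
      exact: cst_continuous.
    apply: (@subspace_eq_continuous _ _ _ g) => [z|].
      by rewrite inE => zB; rewrite /from_subspace AnB// addr0.
    exact: continuous_subspaceT.
  by move=> qc z; apply: cvgB; [exact: qc | exact: fphic].
have qe z : (A `|` B) z -> `|q z| <= e.
  move=> Cz; rewrite /q addrAC [leRHS]splitr (le_trans (ler_normD _ _))//.
  by rewrite lerD ?gf//; case: ifP => _ //; rewrite normr0 ltW.
have [p [pc pe pq]] := extension_from_image cC phic phi_inj qc e0 qe.
exists (fun x => f x + p x).
  split=> [x|x]; first by apply: continuousD; [exact: fc | exact: pc].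
  by rewrite addrAC subrr add0r.
exists eta => // a b Aa Bb.
rewrite !pq; [|by right|by left].
rewrite /q !subrKC (AnB b)// (mem_set Aa) addr0.
have := gap (row_mx a b); rewrite /h row_mxKl row_mxKr.
rewrite opprB addrA [v + _]addrC; apply.
by rewrite /X/= row_mxKl row_mxKr.
Qed.

(** A Baire category argument carried out by hand. Each step moves [F k] by at
    most half of the current tolerance and shrinks the tolerance so much that
    the separation just gained survives every later step: the balls of centre
    [F k] and radius [e k] for the uniform distance are nested. *)
Lemma iterated_separation (R : realType) (N n : nat)
    (S : nat -> 'rV[R]_N -> 'rV[R]_N -> Prop) :
  (forall k (f : 'rV[R]_N -> 'rV[R]_n) e, continuous f -> 0 < e ->
    exists2 f' : 'rV[R]_N -> 'rV[R]_n,
      continuous f' /\ (forall x, `|f' x - f x| <= e) &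
      exists2 g, 0 < g & forall x y, S k x y -> g < `|f' x - f' y|) ->
  exists2 f : 'rV[R]_N -> 'rV[R]_n, continuous f &
    forall k x y, S k x y -> f x != f y.
Proof.
move=> Sstep.
have : forall ks : nat * (('rV[R]_N -> 'rV[R]_n) * R),
  exists s' : ('rV[R]_N -> 'rV[R]_n) * R,
  continuous ks.2.1 -> 0 < ks.2.2 ->
  [/\ continuous s'.1, 0 < s'.2, s'.2 <= ks.2.2 / 2,
     forall x, `|s'.1 x - ks.2.1 x| <= ks.2.2 / 2 &
     forall x y, S ks.1 x y -> 2 * s'.2 < `|s'.1 x - s'.1 y|].
  move=> [k [f e]]/=.
  have [[fc e0]|nfe] := pselect (continuous f /\ 0 < e); last first.
    by exists (f, e) => fc e0; case: nfe.
  have e2 : 0 < e / 2 by rewrite divr_gt0.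
  have [f' [f'c f'f] [g g0 gS]] := Sstep k f _ fc e2.
  exists (f', Num.min (e / 2) (g / 2)) => _ _; split => //=.
  - by rewrite lt_min e2 divr_gt0.
  - by rewrite ge_min lexx.
  - move=> x y /gS; apply: le_lt_trans.
    by rewrite mulrC -ler_pdivlMr// ge_min lexx orbT.
move=> /choice[next nextP].
pose fix s k := if k is k'.+1 then next (k', s k') else (cst 0, 1 : R).
pose F k := (s k).1; pose e k := (s k).2.
have sP k : continuous (F k) /\ 0 < e k.
  elim: k => [|k [Fc e0]].
    by split; [move=> x; exact: cst_continuous | exact: ltr01].
  by have [? ?] := nextP (k, s k) Fc e0.
have stepP k : [/\ e k.+1 <= e k / 2,
    forall x, `|F k.+1 x - F k x| <= e k / 2 &
    forall x y, S k x y -> 2 * e k.+1 < `|F k.+1 x - F k.+1 y|].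
  by have [Fc e0] := sP k; have [] := nextP (k, s k) Fc e0.
have nested k j x : `|F (k + j)%N x - F k x| + e (k + j)%N <= e k.
  elim: j => [|j IH]; first by rewrite addn0 subrr normr0 add0r.
  rewrite addnS; have [ej Fj _] := stepP (k + j)%N; have := Fj x.
  have := ler_normD (F (k + j).+1 x - F (k + j)%N x) (F (k + j)%N x - F k x).
  rewrite subrKA; lra.
have e_small k : e k <= 2^-1 ^+ k.
  elim: k => [|k IH]; first by rewrite expr0.
  rewrite exprSr; have [ek _ _] := stepP k.
  by rewrite (le_trans ek)// ler_pM2r ?invr_gt0.
have ecvg0 (c : R) : 0 < c -> exists k, e k < c.
  move=> c0.
  have /cvgrPdist_lt/(_ _ c0) : (2^-1 : R) ^+ k @[k --> \oo] --> (0 : R).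
    by apply: cvg_expr; rewrite ger0_norm// invf_lt1// ltr1n.
  case=> k _ /(_ k (leqnn k)); rewrite /= sub0r normrN ger0_norm ?exprn_ge0//.
  by move=> kc; exists k; exact: le_lt_trans kc.
have Fcvg x : cvg (F k x @[k --> \oo]).
  apply/cauchy_cvgP/cauchy_exP => c c0; have [k kc] := ecvg0 c c0.
  exists (F k x); exists k => // j /= kj.
  rewrite -ball_normE/= distrC (le_lt_trans _ kc)// -(subnKC kj).
  have := nested k (j - k)%N x; have [_ e0] := sP (k + (j - k))%N; lra.
pose f x := lim (F k x @[k --> \oo]).
have fF k x : `|f x - F k x| <= e k.
  rewrite distrC.
  apply: (closed_cvg _ (@closed_closed_ball_ _ _ (F k x) (e k)) _ _ (Fcvg x)).
  rewrite /closed_ball_.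
  exists k => // j /= kj; rewrite distrC -(subnKC kj).
  have := nested k (j - k)%N x; have [_ e0] := sP (k + (j - k))%N; lra.
exists f => [x|k x y Sxy].
  apply/(@cvgrPdist_lt _ _ _ (nbhs x)) => c c0.
  have [k kc] : exists k, e k < c / 3 by apply: ecvg0; rewrite divr_gt0.
  have [Fc _] := sP k.
  have /cvgrPdist_lt/(_ (c / 3)) := Fc x.
  rewrite divr_gt0// => /(_ isT); apply: (@filterS _ (nbhs x)) => y.
  have := fF k x; have := fF k y.
  have := ler_normD (f x - F k x) (F k x - F k y + (F k y - f y)).
  have := ler_normD (F k x - F k y) (F k y - f y).
  rewrite !subrKA (distrC (F k y)); lra.
apply/eqP => fxy; have [_ _ /(_ x y Sxy)] := stepP k.
have := fF k.+1 x; have := fF k.+1 y.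
have := ler_normB (f y - F k.+1 y) (f x - F k.+1 x).
rewrite fxy opprB addrC subrKA; lra.
Qed.

(** * Embedding theorem *)

(** A Menger-Noebeling embedding theorem. Distinct points [phi a], [phi b] lie
    in the images of small compact cells around [a] and [b], on whose union
    [phi] is injective: on each cell by local injectivity, across cells because
    [phi a] and [phi b] are apart. Countably many cells suffice, so countably
    many separations make the encoder injective. *)
Lemma compact_locally_injective_encodable (R : realType) (d N : nat)
    (K : set 'rV[R]_d) (phi : 'rV[R]_d -> 'rV[R]_N) :
  compact K -> {within K, continuous phi} ->
  (forall z, K z -> exists2 r, 0 < r & set_inj (ball z r `&` K) phi) ->
  encodable (phi @` K) (d + d).+1.
Proof.
move=> cK phic phi_loc.
(* Cells are traces on [K] of closed balls of radius [1 / m.+1] centred on the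
   lattice [(1 / m.+1) Z^d]. *)
pose code := (nat * 'rV[int]_d)%type.
pose mesh (c : code) : R := c.1.+1%:R^-1.
pose center (c : code) : 'rV[R]_d := mesh c *: map_mx intr c.2.
pose cell c := K `&` closed_ball_ Num.norm (center c) (mesh c).
have mesh0 c : 0 < mesh c by rewrite invr_gt0.
have cellC c : compact (cell c).
  by apply: compact_closedI => //; exact: closed_closed_ball_.
have cellK c : cell c `<=` K by move=> z [].
have cell_small c z w : cell c z -> cell c w -> `|z - w| <= 2 * mesh c.
  move=> [_ /= zc] [_ /= wc]; rewrite mulr_natl mulr2n -(subrKA (center c)).
  by rewrite (le_trans (ler_normD _ _))// lerD// distrC.
have cell_cover m z : K z -> cell (m, \row_i Num.floor (m.+1%:R * z ord0 i)) z.
  move=> Kz; split => //=; apply/row_norm_leP => [|i]; first exact: ltW.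
  rewrite !mxE.
  rewrite -[X in _ - X](@mulKf _ (m.+1%:R : R))// -mulrBr normrM gtr0_norm//.
  rewrite ler_piMr// ?(ltW (mesh0 (m, 0)))// distrC.
  have /andP[] := floor_itv (m.+1%:R * z ord0 i); rewrite intrD ler_norml.
  lra.
pose apart A B := A `&` B = set0 /\ set_inj (A `|` B) phi.
(* Numbers that code no pair of cells, and pairs of cells that are not apart,
   give an empty requirement. *)
pose S k x y := if unpickle k is Some (c, c') then
  [/\ apart (cell c) (cell c'), (phi @` cell c) x & (phi @` cell c') y]
  else False.
have [|f fc fS] := @iterated_separation R N (d + d).+1 S.
  move=> k f e fc e0; rewrite /S; case: unpickle => [[c c']|]; last first.
    exists f; last by exists 1.
    by split => // x; rewrite subrr normr0 ltW.
  have [[AB0 inj]|nap] := pselect (apart (cell c) (cell c')); last first.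
    exists f; last by exists 1 => // x y [].
    by split => // x; rewrite subrr normr0 ltW.
  have cc'K : cell c `|` cell c' `<=` K by move=> z [] /cellK.
  have [|f' f'P [g g0 gap]] := separating_perturbation _ (cellC c) (cellC c')
    AB0 (continuous_subspaceW cc'K phic) inj fc e0.
  - exact: ltnSn.
  - exists f' => //; exists g => // x y [_ [a Aa <-] [b Bb <-]].
    exact: gap.
exists f; split; first exact: continuous_subspaceT.
move=> _ _ /set_mem[a Ka <-] /set_mem[b Kb <-] fab.
apply/eqP/negPn/negP => ab.
have eps0 : 0 < `|phi a - phi b| / 2.
  by rewrite divr_gt0// normr_gt0 subr_eq0.
have [dl dl0 phidl] := compact_unif_continuous cK phic eps0.
have [ra ra0 ia] := phi_loc a Ka.
have [rb rb0 ib] := phi_loc b Kb.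
have [m mr] : exists m, 2 * m.+1%:R^-1 < Num.min dl (Num.min ra rb).
  have r0 : 0 < Num.min dl (Num.min ra rb) by rewrite !lt_min dl0 ra0 rb0.
  exists (Num.truncn (2 / Num.min dl (Num.min ra rb))).
  rewrite ltr_pdivrMr// mulrC -ltr_pdivrMr//.
  have /truncn_itv/andP[] // : 0 <= 2 / Num.min dl (Num.min ra rb).
  by rewrite divr_ge0// ltW.
move: mr; rewrite !lt_min => /and3P[mdl ma mb].
pose ca : code := (m, \row_i Num.floor (m.+1%:R * a ord0 i)).
pose cb : code := (m, \row_i Num.floor (m.+1%:R * b ord0 i)).
have caa : cell ca a := cell_cover m a Ka.
have cbb : cell cb b := cell_cover m b Kb.
have phi_neq z w : cell ca z -> cell cb w -> phi z <> phi w.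
  move=> za wb zw.
  have := le_lt_trans (cell_small _ _ _ caa za) mdl.
  move=> /(phidl a z Ka (cellK _ _ za)).
  have := le_lt_trans (cell_small _ _ _ wb cbb) mdl.
  move=> /(phidl w b (cellK _ _ wb) Kb).
  have := ler_normD (phi a - phi z) (phi z - phi b).
  rewrite subrKA zw; lra.
have : S (pickle (ca, cb)) (phi a) (phi b).
  rewrite /S pickleK; split; [split|by exists a|by exists b].
    by rewrite -subset0 => z [za zb]; exact: (phi_neq z z).
  have near_a z : cell ca z -> (ball a ra `&` K) z.
    move=> za; split; last exact: cellK za.
    rewrite -ball_normE/=; exact: le_lt_trans (cell_small _ _ _ caa za) ma.
  have near_b z : cell cb z -> (ball b rb `&` K) z.
    move=> zb; split; last exact: cellK zb.
    rewrite -ball_normE/=; exact: le_lt_trans (cell_small _ _ _ cbb zb) mb.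
  move=> z w /set_mem[] zc /set_mem[] wc zw.
  - by apply: ia => //; rewrite inE; exact: near_a.
  - by case: (phi_neq z w).
  - by case: (phi_neq w z).
  - by apply: ib => //; rewrite inE; exact: near_b.
by move=> /fS; rewrite fab eqxx.
Qed.

(** * Continuity of the solution map *)

(** Continuous dependence on the data is uniform in time, so near [mu] the
    trajectories stay close to that of [mu] on all of [0, T]; the latter is
    continuous in time, and the triangle inequality concludes. *)
Lemma solution_map_continuous (R : realType) (p N : nat) (P : set 'rV[R]_p)
    (T : R) (F : 'rV[R]_N -> 'rV[R]_p -> 'rV[R]_N)
    (u0 : 'rV[R]_p -> 'rV[R]_N) (u : R -> 'rV[R]_p -> 'rV[R]_N) :
  {within P, continuous
    (fun mu => (F ^~ mu : {family compact, 'rV[R]_N -> 'rV[R]_N}))} ->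
  {within P, continuous u0} ->
  (forall mu, P mu -> well_posed T (F ^~ mu) (u0 mu)) ->
  (forall mu, P mu -> is_solution T (F ^~ mu) (u0 mu) (u ^~ mu)) ->
  {within `[0, T] `*` P, continuous (fun q => u q.1 q.2)}.
Proof.
move=> /subspace_continuousP Fc /subspace_continuousP u0c wp sol.
apply/subspace_continuousP => -[t mu] [/= tT Pmu].
apply/cvgrPdist_lt => e e0; have e2 : 0 < e / 2 by rewrite divr_gt0.
have [us [sus uniq dep]] := wp mu Pmu.
have uus s : s \in `[0, T] -> u s mu = us s.
  by apply: (uniq (u ^~ mu)); exact: sol.
have Hmu : \forall mu' \near within P (nbhs mu),
    forall s, s \in `[0, T] -> `|u s mu' - u s mu| < e / 2.
  have [[A B] [/= nA nB] AB] := dep _ e2.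
  have : \forall mu' \near within P (nbhs mu), P mu' by exact: withinT.
  apply: (@filterS3 _ (within P (nbhs mu)) _ _ _ _ _ _
    (Fc mu Pmu A nA) (u0c mu Pmu B nB)) => mu' Amu' Bmu' Pmu' s sT.
  rewrite uus//.
  exact: (AB (F ^~ mu', u0 mu') (conj Amu' Bmu')) (sol _ Pmu') s sT.
have Ht : \forall s \near within `[0, T] (nbhs t), `|u t mu - u s mu| < e / 2.
  have [/subspace_continuousP uc _ _] := sol mu Pmu.
  by move/cvgrPdist_lt : (uc t tT); exact.
rewrite near_withinE.
exists ([set s | s \in `[0, T] -> `|u t mu - u s mu| < e / 2],
        [set mu' | P mu' -> forall s, s \in `[0, T] ->
                     `|u s mu' - u s mu| < e / 2]) => //=.
move=> [s mu']/= [Hs Hmu'] [sT Pmu'].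
rewrite -(subrKA (u s mu)) (le_lt_trans (ler_normD _ _))// [ltRHS]splitr.
by rewrite ltrD ?Hs// distrC Hmu'.
Qed.

(** * Latent dimension of the solution manifold *)

(** The product is identified with [R^(1 + p)] isometrically for the sup
    norms. *)
Lemma compact_locally_injective_encodable_prod (R : realType) (p N : nat)
    (I : set R) (P : set 'rV[R]_p) (u : R -> 'rV[R]_p -> 'rV[R]_N) :
  compact I -> compact P ->
  {within I `*` P, continuous (fun q => u q.1 q.2)} ->
  (forall t mu, I t -> P mu -> exists2 r, 0 < r &
    set_inj (ball ((t, mu) : R * 'rV[R]_p) r `&` (I `*` P))
      (fun q => u q.1 q.2)) ->
  encodable [set u t mu | t in I & mu in P] (p.+1 + p.+1).+1.
Proof.
move=> cI cP uc u_loc.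
pose join (q : R * 'rV[R]_p) : 'rV[R]_(1 + p) := row_mx (const_mx q.1) q.2.
pose unjoin (w : 'rV[R]_(1 + p)) := (lsubmx w ord0 ord0, rsubmx w).
have joinK q : unjoin (join q) = q.
  by rewrite /unjoin /join row_mxKl row_mxKr mxE -surjective_pairing.
have join_dist q q' : `|join q - join q'| <= 1 * `|q - q'|.
  rewrite mul1r; apply/row_norm_leP => // i; rewrite prod_normE le_max !mxE.
  case: splitP => j _; first by rewrite !mxE lexx.
  apply/orP; right; have := row_norm_ge (q.2 - q'.2) j.
  by rewrite !mxE.
have unjoin_dist w w' : `|unjoin w - unjoin w'| <= 1 * `|w - w'|.
  rewrite mul1r prod_normE ge_max; apply/andP; split.
    by have := row_norm_ge (w - w') (lshift p ord0); rewrite /= !mxE.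
  apply/row_norm_leP => // i.
  by have := row_norm_ge (w - w') (rshift 1 i); rewrite /= !mxE.
have join_cont := lipschitz_bound_continuous join_dist.
have unjoin_cont := lipschitz_bound_continuous unjoin_dist.
pose phi w := u (unjoin w).1 (unjoin w).2.
pose K := join @` (I `*` P).
have KP w : K w -> (I `*` P) (unjoin w) by move=> [q q_in <-]; rewrite joinK.
have -> : [set u t mu | t in I & mu in P] = phi @` K.
  apply/seteqP; split => x.
    move=> [t It [mu Pmu <-]]; exists (join (t, mu)); first by exists (t, mu).
    by rewrite /phi joinK.
  move=> [_ [[t mu] [/= It Pmu] <-] <-]; rewrite /phi joinK.
  by exists t => //; exists mu.
apply: (@compact_locally_injective_encodable _ (1 + p)).
- apply: continuous_compact; last exact: compact_setX.
  exact: continuous_subspaceT.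
- apply/subspace_continuousP => w Kw.
  have /subspace_continuousP/(_ _ (KP w Kw)) := uc; apply: cvg_trans.
  move=> A /=; rewrite /nbhs/= /within/= => nA.
  have := unjoin_cont w _ nA; apply: (@filterS _ (nbhs w)) => w' wA Kw'.
  exact/wA/KP.
- move=> w Kw; have [It Pmu] := KP w Kw.
  have [r r0 inj] := u_loc _ _ It Pmu.
  exists r => // w1 w2 /set_mem[wr1 K1] /set_mem[wr2 K2] E.
  have wr w' : ball w r w' -> ball (unjoin w) r (unjoin w').
    rewrite -!ball_normE/=; apply: le_lt_trans.
    by have := unjoin_dist w w'; rewrite mul1r.
  have : unjoin w1 = unjoin w2.
    by apply: inj => //; rewrite inE; split; do ?exact: wr; exact: KP.
  by case: K1 K2 => [q1 _ <-] [q2 _ <-]; rewrite !joinK => ->.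
Qed.

Theorem theorem4 (R : realType) (a N : nat) (P : set 'rV[R]_(a - 1)) (T : R)
    (F : 'rV[R]_N -> 'rV[R]_(a - 1) -> 'rV[R]_N)
    (u0 : 'rV[R]_(a - 1) -> 'rV[R]_N)
    (u : R -> 'rV[R]_(a - 1) -> 'rV[R]_N) :
  (1 <= a - 1)%N ->
  compact P ->
  P° !=set0 ->
  0 < T ->
  {within P, continuous
    (fun mu => (F ^~ mu : {family compact, 'rV[R]_N -> 'rV[R]_N}))} ->
  {within P, continuous u0} ->
  (forall mu, P mu -> well_posed T (F ^~ mu) (u0 mu)) ->
  (forall mu, P mu -> is_solution T (F ^~ mu) (u0 mu) (u ^~ mu)) ->
  (forall (t : R) (mu : 'rV[R]_(a - 1)), t \in `[0, T] -> P mu ->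
    \forall r \near 0^'+,
      set_inj (closed_ball ((t, mu) : R * 'rV[R]_(a - 1)) r
                 `&` (`[0, T] `*` P))
              (fun p => u p.1 p.2)) ->
  (min_latent_dim (solution_manifold T P u) <= 2 * a + 1)%N.
Proof.
move=> a1 cP _ _ Fc u0c wp sol u_inj.
have uc := solution_map_continuous Fc u0c wp sol.
have : encodable (solution_manifold T P u) ((a - 1).+1 + (a - 1).+1).+1.
  apply: compact_locally_injective_encodable_prod => //.
    exact: segment_compact.
  move=> t mu tT Pmu.
  have [r [r0 inj]] :=
    filter_ex (filterI (nbhs_right_gt (0 : R)) (u_inj t mu tT Pmu)).
  exists r => // q1 q2 /set_mem[b1 q1in] /set_mem[b2 q2in].
  by apply: inj; rewrite inE; split => //; exact: subset_closed_ball.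
have -> : ((a - 1).+1 + (a - 1).+1).+1 = (2 * a + 1)%N.
  by rewrite subn1 prednK ?addnn ?mul2n ?addn1//; case: (a) a1.
rewrite /min_latent_dim; case: ex_minnP => n _ n_min enc.
by apply: n_min; apply/asboolP.
Qed.
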